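(* Let $\Pi\subseteq\mathfrak{S}_3$ with $1\leq|\Pi|\leq 3$. Then the statistics $\mathrm{fix}$ and $\mathrm{pix}$ are equidistributed over $\mathfrak{S}_n(\Pi)$ for all $n\geq 0$ (that is, for all $n\ge 0$ and $j\ge 0$, the number of $\pi\in\mathfrak{S}_n(\Pi)$ with $\mathrm{fix}(\pi)=j$ equals the number with $\mathrm{pix}(\pi)=j$) if and only if $\Pi$ is one of the following: $\{132,312\}$, $\{132,321\}$, $\{213,231\}$, $\{123,132,312\}$, $\{123,213,231\}$, $\{123,312,321\}$, $\{132,312,321\}$, $\{213,231,312\}$, or $\{213,231,321\}$.
   Context: $\mathfrak{S}_n$ is the set of permutations $\pi=\pi_1\pi_2\cdots\pi_n$ of $[n]=\{1,\dots,n\}$ in one-line notation; $\mathfrak{S}_0$ consists of the empty permutation. The standardization of a sequence of distinct positive integers of length $m$ is the permutation in $\mathfrak{S}_m$ obtained by replacing its smallest letter by 1, the second smallest by 2, and so on. A permutation $\pi$ avoids a pattern $\sigma$ if no (not necessarily consecutive) subsequence of $\pi$ has standardization $\sigma$. $\mathfrak{S}_n(\Pi)$ is the set of permutations in $\mathfrak{S}_n$ avoiding every pattern in $\Pi$. $\mathrm{fix}(\pi)$ is the number of $i\in[n]$ with $\pi_i=i$. For a sequence of distinct positive integers $\pi=\pi_1\cdots\pi_n$, an index $i\in[n-1]$ is an ascent if $\pi_i<\pi_{i+1}$ and a descent if $\pi_i>\pi_{i+1}$; an index $i\in [n]$ is a non-descent if $i$ is an ascent or $i=n$. A desarrangement is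 a sequence of distinct positive integers whose first (smallest) non-descent is even; the empty sequence is also a desarrangement. Every permutation $\pi$ can be written uniquely as a concatenation $\pi=\iota\delta$ where $\iota$ is an increasing (possibly empty) sequence and $\delta$ is a desarrangement (possibly empty); $\mathrm{pix}(\pi)$ is the length of $\iota$. *)

(* Defs.v *)
From mathcomp Require Import all_boot all_fingroup.

Set Implicit Arguments.
Unset Strict Implicit.
Unset Printing Implicit Defensive.

(* One-line notation with letters 1, ..., n; 'S_n itself permutes 0, ..., n-1. *)
Definition word n (p : 'S_n) : seq nat := [seq (p i).+1 | i <- enum 'I_n].

(* On distinct letters, the rank of x is the number of letters <= x. *)
Definition standardization (s : seq nat) : seq nat :=
  [seq count (fun y => y <= x) s | x <- s].

(* The subsequences of [word p] are its masks by n-tuples of booleans. *)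
Definition avoids n k (p : 'S_n) (s : 'S_k) : bool :=
  [forall m : n.-tuple bool, standardization (mask m (word p)) != word s].

Definition avoiders n k (P : {set 'S_k}) : {set 'S_n} :=
  [set p : 'S_n | [forall s in P, avoids p s]].

Definition fix_stat n (p : 'S_n) : nat := #|[set i | p i == i]|.

(* Positions are counted from 1: the i-th letter of s is [nth 0 s i.-1]. *)
Definition nondescent (s : seq nat) (i : nat) : bool :=
  (i == size s) || (nth 0 s i.-1 < nth 0 s i).

(* Smallest non-descent; a nonempty s always has one, namely [size s]. *)
Definition first_nondescent (s : seq nat) : nat :=
  head 0 [seq i <- iota 1 (size s) | nondescent s i].

Definition desarrangement (s : seq nat) : bool :=
  (s == [::]) || ~~ odd (first_nondescent s).

Definition pix_split (s : seq nat) (k : nat) : bool :=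
  sorted ltn (take k s) && desarrangement (drop k s).

(* [find] returns the only k <= size s with [pix_split s k], see
   [pix_split_unique] and [pix_statP]. *)
Definition pix_seq (s : seq nat) : nat := find (pix_split s) (iota 0 (size s).+1).

Definition pix_stat n (p : 'S_n) : nat := pix_seq (word p).

Definition equidistributed n (A : {set 'S_n}) (f g : 'S_n -> nat) : Prop :=
  forall j, #|[set p in A | f p == j]| = #|[set p in A | g p == j]|.

Definition patterns k (ws : seq (seq nat)) : {set 'S_k} :=
  [set s : 'S_k | word s \in ws].

Lemma first_nondescent_cons2 x y t :
  first_nondescent [:: x, y & t] =
  if x < y then 1 else (first_nondescent (y :: t)).+1.
Proof.
rewrite /first_nondescent.
have -> : iota 1 (size [:: x, y & t]) = 1 :: map (addn 1) (iota 1 (size t).+1).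
  by rewrite -iotaDl.
have eq_nd : [seq i <- iota 1 (size t).+1 | nondescent [:: x, y & t] (1 + i)]
           = [seq i <- iota 1 (size t).+1 | nondescent (y :: t) i].
  by apply: eq_in_filter => -[|i]; rewrite mem_iota /nondescent ?add1n.
have : has (nondescent (y :: t)) (iota 1 (size t).+1).
  apply/hasP; exists (size t).+1; first by rewrite mem_iota add1n ltnS leqnn.
  by rewrite /nondescent eqxx.
rewrite has_filter [size (y :: t)]/=; move: eq_nd; move: (iota 1 _) => l eq_nd.
rewrite [LHS]/= filter_map [filter (preim _ _) _]eq_nd.
have -> : nondescent [:: x, y & t] 1 = (x < y) by [].
by case: (x < y) => //; case: (filter _ _).
Qed.

Lemma pix_split_unique (s : seq nat) :
  uniq s -> exists! k, k <= size s /\ pix_split s k.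
Proof.
elim: s => [|x [|y t] IHs] Us.
- by exists 0; split=> // k [] /=; case: k.
- by exists 1; split=> // -[|[|k]] [].
have /andP[xNyt Uyt] : (x \notin y :: t) && uniq (y :: t) := Us.
have {IHs} [k [[le_k_s Sk] k_unique]] := IHs Uyt.
have splitS j : pix_split [:: x, y & t] j.+1 =
                ((j == 0) || (x < y)) && pix_split (y :: t) j.
  by case: j => [|j]; rewrite /pix_split /= ?andbT // andbA.
have split0 : pix_split [:: x, y & t] 0 = ~~ (x < y) && ~~ pix_split (y :: t) 0.
  rewrite /pix_split /= /desarrangement first_nondescent_cons2 /=.
  by case: (x < y).
case: (ltnP x y) => [lt_xy | le_yx].
  exists k.+1; split=> [|[|j]]; first by rewrite splitS lt_xy orbT.
    by rewrite split0 lt_xy; case.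
  rewrite splitS lt_xy orbT => -[le_j Sj].
  by congr _.+1; apply: k_unique.
have Nxy : (x < y) = false by rewrite ltnNge le_yx.
case S0: (pix_split (y :: t) 0).
  exists 1; split=> [|[|[|j]]] //.
    by rewrite split0 S0 andbF; case.
  by rewrite splitS Nxy; case.
exists 0; split=> [|[|[|j]]] //; first by rewrite split0 S0 Nxy.
  by rewrite splitS S0 andbF; case.
by rewrite splitS Nxy; case.
Qed.

Lemma word_uniq n (p : 'S_n) : uniq (word p).
Proof.
by rewrite map_inj_uniq ?enum_uniq // => i j [] /val_inj /perm_inj.
Qed.

Lemma pix_statP n (p : 'S_n) :
  pix_stat p <= n /\ pix_split (word p) (pix_stat p).
Proof.
have szw : size (word p) = n by rewrite size_map size_enum_ord.
have [k [[le_k Sk] _]] := pix_split_unique (word_uniq p).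
have hasS : has (pix_split (word p)) (iota 0 (size (word p)).+1).
  by apply/hasP; exists k; rewrite // mem_iota /= add0n ltnS.
have := nth_find 0 hasS; move: hasS; rewrite has_find size_iota -/(pix_seq _) => lt_p.
by rewrite nth_iota // add0n /pix_stat; split=> //; rewrite -ltnS -{2}szw.
Qed.

(* Main.v *)
Require Import Defs.
From mathcomp Require Import all_boot all_fingroup zify.

Set Implicit Arguments.
Unset Strict Implicit.
Unset Printing Implicit Defensive.

(**
  Every set of patterns outside the list already fails for some n <= 5, which is
  a finite computation.

  A permutation avoids {213, 231} iff each letter is the least or the greatest of
  those from it on, so it is coded by a bit sequence, which is also its sequence
  of ascents; reversal gives {132, 312}.  On bit sequences both statistics gain 1
  from a leading ascent, and after a leading descent both are 0 or 1.  Hence it is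
  enough to count, over the remaining bits, the words having some w_i = i + 1 and
  those with pix = 0: both counts are Jacobsthal numbers (for all bit sequences) or
  m/2 rounded up (for at most one ascent).  Avoiding a third pattern restricts the
  bit sequences, and reversal preserves the restricted sets that are needed.

  For {132, 321} the permutations other than the identity are exchanges of two
  initial blocks, counted by recursion on n; for {123, 312, 321} none is left once
  n > 4.
*)

(** * Words of permutations and pattern avoidance *)

Lemma perm_word n (p : 'S_n) : perm_eq (word p) (iota 1 n).
Proof.
have szw : size (word p) = n by rewrite size_map size_enum_ord.
apply: uniq_perm; rewrite ?word_uniq ?iota_uniq //.
have sub : {subset word p <= iota 1 n}.
  by move=> _ /mapP[i _ ->]; rewrite mem_iota /= add1n ltnS ltn_ord.
by have [] := uniq_min_size (word_uniq p) sub; rewrite ?size_iota ?szw.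
Qed.

Lemma word_surj n (w : seq nat) :
  perm_eq w (iota 1 n) -> exists p : 'S_n, word p = w.
Proof.
move=> pw; have szw : size w = n by rewrite (perm_size pw) size_iota.
have Uw : uniq w by rewrite (perm_uniq pw) iota_uniq.
have wP i : i < n -> 0 < nth 0 w i <= n.
  move=> lt_i_n; have: nth 0 w i \in w by rewrite mem_nth ?szw.
  by rewrite (perm_mem pw) mem_iota add1n ltnS.
(* The default value [i] is never taken, since [wP] puts every lowered letter below [n]. *)
pose f (i : 'I_n) : 'I_n := insubd i (nth 0 w i).-1.
have fE i : (f i).+1 = nth 0 w i.
  have /andP[w_gt0 w_le] := wP i (ltn_ord i).
  by rewrite val_insubd prednK // w_le prednK.
have f_inj : injective f.
  move=> i j /(congr1 (fun k : 'I_n => k.+1)); rewrite !fE => /eqP.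
  by rewrite nth_uniq ?szw // => /eqP /val_inj.
exists (perm f_inj); apply: (@eq_from_nth _ 0).
  by rewrite size_map size_enum_ord szw.
move=> i; rewrite size_map size_enum_ord => lt_i_n.
by rewrite (nth_map (Ordinal lt_i_n)) ?size_enum_ord // permE fE nth_enum_ord.
Qed.

Lemma word_inj n : injective (@word n).
Proof.
move=> p q eq_pq; apply/permP=> i; apply/val_inj.
have nthw (r : 'S_n) : nth 0 (word r) i = (r i).+1.
  by rewrite (nth_map i) ?size_enum_ord ?nth_ord_enum.
by apply/eqP; rewrite -eqSS -!nthw eq_pq.
Qed.

(** A pattern of length three becomes a relation [r] on letters in order of position. Fixing the
    first letter leaves a condition on pairs, which suits induction on the word. *)
Fixpoint avoidw (r : nat -> nat -> nat -> bool) (w : seq nat) : bool :=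
  if w is x :: t then pairwise (fun y z => ~~ r x y z) t && avoidw r t else true.

Lemma pairwise_subseqP (T : eqType) (e : rel T) (s : seq T) :
  reflect (forall x y, subseq [:: x; y] s -> e x y) (pairwise e s).
Proof.
apply: (iffP idP) => [es x y /subseq_pairwise/(_ es) /=|]; first by rewrite !andbT.
elim: s => //= x s IHs es; apply/andP; split.
  by apply/allP=> y ys; apply: es; rewrite eqxx sub1seq.
apply: IHs => y z yz_s; apply: es; case: eqP => // _.
exact: subseq_trans (subseq_cons _ _) yz_s.
Qed.

Lemma avoidwP r w :
  reflect (forall x y z, subseq [:: x; y; z] w -> ~~ r x y z) (avoidw r w).
Proof.
elim: w => [|a w IHw]; first by left.
rewrite [avoidw _ _]/=; apply: (iffP andP) => [[/pairwise_subseqP rw /IHw av] | av].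
  move=> x y z /=; case: eqP => [-> | _]; [exact: rw | exact: av].
split; first by apply/pairwise_subseqP=> x y xy_w; apply: av; rewrite /= eqxx.
apply/IHw=> x y z xyz_w; apply: av.
exact: subseq_trans xyz_w (subseq_cons _ _).
Qed.

Definition pattern_words k (P : {set 'S_k}) : seq (seq nat) := [seq word s | s in P].

Definition has_pattern (S : seq (seq nat)) (x y z : nat) : bool :=
  standardization [:: x; y; z] \in S.

(** Standardization keeps the length, so a mask that matches a pattern of length three selects
    exactly three letters. *)
Lemma mem_avoiders n (P : {set 'S_3}) (p : 'S_n) :
  (p \in avoiders n P) = avoidw (has_pattern (pattern_words P)) (word p).
Proof.
have szw k (q : 'S_k) : size (word q) = k by rewrite size_map size_enum_ord.
rewrite inE; apply/'forall_implyP/avoidwP => [av x y z /subseqP[m szm xyzE] | av s sP].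
  apply/negP=> /imageP[s sP]; rewrite xyzE.
  have szm' : size m == n by rewrite szm szw.
  by move/forallP: (av s sP) => /(_ (Tuple szm'))/eqP.
apply/forallP=> m; apply/eqP=> ms.
have := congr1 size ms; rewrite szw size_map.
case mE: (mask m (word p)) => [|x [|y [|z [|]]]] // _.
have := av x y z; rewrite -mE mask_subseq => /(_ isT)/negP; apply.
by rewrite /has_pattern -mE ms; apply: image_f.
Qed.

(** Counting permutations is replaced by counting over a duplicate-free list, which each class may
    enumerate in its own way. *)
Definition lists_avoiders n (S : seq (seq nat)) (L : seq (seq nat)) : Prop :=
  uniq L /\ forall w, (w \in L) = perm_eq w (iota 1 n) && avoidw (has_pattern S) w.

Lemma card_avoiders n (P : {set 'S_3}) L (f : seq nat -> nat) j :
    lists_avoiders n (pattern_words P) L ->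
  #|[set p in avoiders n P | f (word p) == j]| = count (fun w => f w == j) L.
Proof.
move=> [UL memL]; have /seq.permP <- : perm_eq [seq word p | p in avoiders n P] L.
  apply: uniq_perm => // [|w]; first by rewrite map_inj_uniq ?enum_uniq //; exact: word_inj.
  rewrite memL; apply/imageP/andP => [[p pP ->]|[/word_surj[p <-]]].
    by rewrite perm_word -mem_avoiders.
  by rewrite -mem_avoiders => pP; exists p.
rewrite count_map -sum1_count big_enum_cond /= -sum1_card.
by apply: eq_bigl => p; rewrite inE.
Qed.

(* [count_shifted k l w] counts the i with w_i + l = i + k, positions starting at 1. *)
Fixpoint count_shifted (k l : nat) (w : seq nat) : nat :=
  if w is x :: t then (x + l == k.+1) + count_shifted k.+1 l t else 0.

Definition fix_seq (w : seq nat) : nat := count_shifted 0 0 w.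

Lemma count_shiftedE k l w :
  count_shifted k l w =
  \sum_(i < size w) (nth 0 w i + l == (i + k).+1).
Proof.
elim: w k => [|x w IHw] k; first by rewrite big_ord0.
rewrite big_ord_recl /= IHw; congr (_ + _).
by apply: eq_bigr => i _; rewrite /bump /= addnS.
Qed.

Lemma fix_statE n (p : 'S_n) : fix_stat p = fix_seq (word p).
Proof.
have szw : size (word p) = n by rewrite size_map size_enum_ord.
rewrite /fix_seq count_shiftedE szw /fix_stat -sum1_card big_mkcond /=.
apply: eq_bigr => i _; rewrite inE addn0 addn0.
rewrite (nth_map i) ?size_enum_ord ?nth_ord_enum // eqSS.
Qed.

(** Comparing the two multisets of values gives a boolean, which can be computed for small classes
    and is stable under reindexing the list. *)
Definition equidistributed_on (T : eqType) (L : seq T) (f g : T -> nat) : bool :=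
  perm_eq (map f L) (map g L).

Lemma equidistributed_onP (T : eqType) (L : seq T) (f g : T -> nat) :
  reflect (forall j, count (fun w => f w == j) L = count (fun w => g w == j) L)
          (equidistributed_on L f g).
Proof.
apply: (iffP idP) => [/seq.permP fg j|fg]; first by have := fg (pred1 j); rewrite !count_map.
by apply/allP=> j _ /=; rewrite !count_map; apply/eqP/fg.
Qed.

Lemma equidistributed_avoiders n (P : {set 'S_3}) L :
    lists_avoiders n (pattern_words P) L ->
  equidistributed (avoiders n P) (@fix_stat n) (@pix_stat n) <->
  equidistributed_on L fix_seq pix_seq.
Proof.
move=> LP; have fixE j : #|[set p in avoiders n P | fix_stat p == j]| =
                         count (fun w => fix_seq w == j) L.
  by rewrite -(card_avoiders _ _ LP); apply: eq_card => p; rewrite !inE fix_statE.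
have pixE j : #|[set p in avoiders n P | pix_stat p == j]| =
              count (fun w => pix_seq w == j) L := card_avoiders pix_seq j LP.
split=> [eqP | /equidistributed_onP eqL j]; last by rewrite fixE pixE.
by apply/equidistributed_onP=> j; rewrite -fixE -pixE.
Qed.

(** * Pix from ascents, and words avoiding 213 and 231 *)

Lemma pix_seq_eq s k : uniq s -> k <= size s -> pix_split s k -> pix_seq s = k.
Proof.
move=> Us le_k Sk; have [k0 [_ k0_unique]] := pix_split_unique Us.
rewrite -(k0_unique k) //; symmetry; apply: k0_unique.
have hasS : has (pix_split s) (iota 0 (size s).+1).
  by apply/hasP; exists k; rewrite // mem_iota.
have := nth_find 0 hasS; move: hasS; rewrite has_find size_iota -/(pix_seq s) => lt_p.
by rewrite nth_iota.
Qed.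

Lemma pix_seqP s : uniq s -> pix_seq s <= size s /\ pix_split s (pix_seq s).
Proof.
move=> Us; have [k [[le_k Sk] _]] := pix_split_unique Us.
by rewrite (pix_seq_eq Us le_k Sk).
Qed.

(** After an initial descent the increasing prefix has at most one letter. It has one exactly when
    [y :: t] is a desarrangement; otherwise prepending [x] turns the odd first non-descent into an
    even one. *)
Lemma pix_seq_cons2 x y t : uniq [:: x, y & t] ->
  pix_seq [:: x, y & t] =
  if x < y then (pix_seq (y :: t)).+1 else pix_seq (y :: t) == 0.
Proof.
move=> Us; have Ut : uniq (y :: t) by case/andP: Us.
have [le_p Sp] := pix_seqP Ut.
have splitS j : pix_split [:: x, y & t] j.+1 =
                ((j == 0) || (x < y)) && pix_split (y :: t) j.
  by case: j => [|j]; rewrite /pix_split /= ?andbT // andbA.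
have split0 : pix_split [:: x, y & t] 0 = ~~ (x < y) && ~~ pix_split (y :: t) 0.
  rewrite /pix_split /= /desarrangement first_nondescent_cons2 /=.
  by case: (x < y).
case: ifP => lt_xy; first by apply: pix_seq_eq; rewrite ?splitS ?lt_xy ?orbT.
case: eqP => p0; apply: pix_seq_eq => //; first by rewrite splitS /= -p0.
rewrite split0 lt_xy /=; apply/negP=> S0.
by case: p0; apply: pix_seq_eq.
Qed.

Definition ascents (w : seq nat) : seq bool :=
  if w is x :: t then pairmap ltn x t else [::].

(** The recursion of [pix_seq_cons2] read on ascents. The empty bit sequence stands for a one-letter
    word, whose pix is 1. *)
Fixpoint pix_bits (b : seq bool) : nat :=
  if b is u :: b' then if u then (pix_bits b').+1 else pix_bits b' == 0 else 1.

Lemma pix_seq_ascents w : uniq w -> w != [::] -> pix_seq w = pix_bits (ascents w).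
Proof.
elim: w => [|x [|y t] IHw] // Uw _; rewrite pix_seq_cons2 // IHw //.
by case/andP: Uw.
Qed.

Lemma ascents_rcons2 t x y :
  ascents (rcons (rcons t x) y) = rcons (ascents (rcons t x)) (x < y).
Proof.
case: t => [|z t] //=; rewrite -[rcons (rcons t x) y]cats1 pairmap_cat /= last_rcons.
by rewrite cats1.
Qed.

Lemma ascents_rev w : uniq w -> ascents (rev w) = rev (map negb (ascents w)).
Proof.
elim: w => [|x [|y t] IHw] // Uw.
rewrite rev_cons (rev_cons y) ascents_rcons2 -rev_cons IHw; last by case/andP: Uw.
rewrite [in RHS]/= rev_cons; congr rcons.
by move: Uw => /=; case: ltngtP => // ->; rewrite inE eqxx.
Qed.

Fixpoint bits (m : nat) : seq (seq bool) :=
  if m is m'.+1 then map (cons true) (bits m') ++ map (cons false) (bits m')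
  else [:: [::]].

Lemma mem_bits m b : (b \in bits m) = (size b == m).
Proof.
elim: m b => [|m IHm] [|u b] //; rewrite [bits _]/= mem_cat.
  by apply: negbTE; rewrite negb_or; apply/andP; split; apply/mapP=> -[].
have consE v : ((u :: b) \in map (cons v) (bits m)) = (u == v) && (size b == m).
  apply/mapP/andP => [[c cm [-> ->]] | [/eqP-> bm]]; first by rewrite -IHm.
  by exists b; rewrite // IHm.
by rewrite !consE eqSS; case: u {consE}; rewrite /= ?orbF.
Qed.

Lemma uniq_bits m : uniq (bits m).
Proof.
elim: m => // m IHm; rewrite /= cat_uniq !map_inj_uniq ?IHm => [|? ? []|? ? []] //.
by rewrite andbT /=; apply/hasPn=> _ /mapP[b _ ->]; apply/mapP=> -[].
Qed.

(* The words in which every letter is the least (bit [true]) or the greatest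
   (bit [false]) of the letters from it on. *)
Fixpoint minmax_word (b : seq bool) : seq nat :=
  if b is u :: b' then
    if u then 1 :: map succn (minmax_word b') else (size b').+2 :: minmax_word b'
  else [:: 1].

Lemma size_minmax b : size (minmax_word b) = (size b).+1.
Proof. by elim: b => [|[] b IHb] //=; rewrite ?size_map IHb. Qed.

Lemma iota_rcons n : iota 1 n.+1 = rcons (iota 1 n) n.+1.
Proof. by rewrite -[n.+1 in LHS]addn1 iotaD add1n cats1. Qed.

Lemma perm_minmax b : perm_eq (minmax_word b) (iota 1 (size b).+1).
Proof.
elim: b => [|[] b IHb] //=.
  by rewrite perm_cons -[2 :: _]/(iota (1 + 1) (size b).+1) iotaDl; apply: perm_map.
by rewrite -[_ :: _ :: iota _ _]/(iota 1 (size b).+2) iota_rcons perm_sym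
  perm_rcons perm_cons perm_sym.
Qed.

Lemma mem_minmax b x : (x \in minmax_word b) = (0 < x <= (size b).+1).
Proof. by rewrite (perm_mem (perm_minmax b)) mem_iota add1n ltnS. Qed.

Lemma uniq_minmax b : uniq (minmax_word b).
Proof. by rewrite (perm_uniq (perm_minmax b)) iota_uniq. Qed.

Lemma ascents_map_succ w : ascents (map succn w) = ascents w.
Proof. by case: w => //= x t; elim: t x => //= y t IHt x; rewrite IHt. Qed.

Lemma ascents_minmax b : ascents (minmax_word b) = b.
Proof.
elim: b => [|u b IHb] //=; rewrite -[in RHS]IHb.
move: (mem_minmax b); case: (minmax_word b) (size_minmax b) => [|x t] // _ xP.
have := xP x; rewrite mem_head => /esym x_bnd.
have shift : pairmap ltn x.+1 (map succn t) = pairmap ltn x t.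
  exact: ascents_map_succ (x :: t).
have [x_gt0 x_le] : 0 < x /\ x <= (size b).+1 by apply/andP.
case: u => /=; rewrite ?shift; congr cons => //.
by apply: negbTE; rewrite -leqNgt leqW.
Qed.

Lemma minmax_inj : injective minmax_word.
Proof. exact: can_inj ascents_minmax. Qed.

Lemma avoidw_map_succ r w :
  avoidw r (map succn w) = avoidw (fun x y z => r x.+1 y.+1 z.+1) w.
Proof. by elim: w => //= x w ->; rewrite pairwise_map. Qed.

Lemma avoidwU r1 r2 w :
  avoidw (fun x y z => r1 x y z || r2 x y z) w = avoidw r1 w && avoidw r2 w.
Proof.
elim: w => //= x w ->; rewrite andbACA -pairwise_relI; congr (_ && _).
by apply: eq_pairwise => y z /=; rewrite negb_or.
Qed.

Lemma avoidw_rev r w : avoidw r (rev w) = avoidw (fun x y z => r z y x) w.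
Proof.
by apply/avoidwP/avoidwP => av x y z xyz_w; apply: av; rewrite -subseq_rev ?revK.
Qed.

Lemma eq_avoidw r1 r2 w : uniq w ->
    (forall x y z, uniq [:: x; y; z] -> r1 x y z = r2 x y z) ->
  avoidw r1 w = avoidw r2 w.
Proof.
move=> Uw r12; apply/avoidwP/avoidwP => av x y z xyz_w; have := av _ _ _ xyz_w.
  by rewrite r12 // (subseq_uniq xyz_w).
by rewrite r12 // (subseq_uniq xyz_w).
Qed.

Lemma subseq_pair (T : eqType) (x y : T) s :
  x \in s -> y \in s -> x != y -> subseq [:: x; y] s || subseq [:: y; x] s.
Proof.
elim: s => // z s IHs; rewrite !inE /=.
have [->|xz] := eqVneq x z; have [->|yz] := eqVneq y z; rewrite ?eqxx //=.
- by move=> _ ys _; rewrite sub1seq ys.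
- by move=> xs _ _; rewrite sub1seq xs orbT.
Qed.

(** The two disjuncts are the patterns 213 and 231. *)
Definition middle_first (x y z : nat) : bool := (y < x < z) || (z < x < y).

Lemma avoid_middle_first_minmax b : avoidw middle_first (minmax_word b).
Proof.
elim: b => [|[] b IHb] //=; rewrite ?avoidw_map_succ IHb andbT;
  apply/pairwise_subseqP=> y z /mem_subseq yz; rewrite /middle_first.
  by move: (yz y) (yz z); rewrite !inE !eqxx orbT => /(_ isT)/mapP[y' _ ->] /(_ isT)/mapP[z' _ ->].
by move: (yz y) (yz z); rewrite !inE !eqxx orbT !mem_minmax => /(_ isT) ? /(_ isT) ?; lia.
Qed.

(** If the first letter were neither the least nor the greatest, both extremes would follow it and
    form 213 or 231 with it. So it is extreme, and the rest is treated by induction. *)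
Lemma avoid_middle_first m w :
    perm_eq w (iota 1 m.+1) -> avoidw middle_first w ->
  exists2 b, size b = m & w = minmax_word b.
Proof.
elim: m w => [|m IHm] w pw.
  by exists [::] => //; apply/perm_small_eq.
case: w pw => [/perm_size//|x t] pw /= /andP[/pairwise_subseqP xt at_].
have memw y : (y \in x :: t) = (0 < y <= m.+2).
  by rewrite (perm_mem pw) mem_iota add1n ltnS.
have /orP[/eqP x1 | /eqP xm] : (x == 1) || (x == m.+2).
  apply/negPn/negP; rewrite negb_or => /andP[x1 xm].
  have x_bnd : 0 < x <= m.+2 by rewrite -memw mem_head.
  have mem_t y : y != x -> 0 < y <= m.+2 -> y \in t.
    by move=> /negPf yx; rewrite -memw inE yx.
  have t1 : 1 \in t by rewrite mem_t // eq_sym.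
  have tm : m.+2 \in t by rewrite mem_t ?leqnn // eq_sym.
  by case/orP: (subseq_pair t1 tm isT) => /xt; rewrite /middle_first; lia.
- have tE : t = map succn (map predn t).
    rewrite -map_comp map_id_in // => y yt /=; apply: prednK.
    by have := memw y; rewrite inE yt orbT => /esym/andP[].
  have pt : perm_eq (map predn t) (iota 1 m.+1).
    have {pw} pt : perm_eq t (map succn (iota 1 m.+1)).
      by move: pw; rewrite x1 -[iota 1 m.+2]/(1 :: iota (1 + 1) m.+1) perm_cons iotaDl.
    by have := perm_map predn pt; rewrite -map_comp map_id.
  move: at_; rewrite tE avoidw_map_succ => /(IHm _ pt)[b bm ->].
  by exists (true :: b); rewrite /= ?bm ?x1.
- have pt : perm_eq t (iota 1 m.+1).
    by move: pw; rewrite xm iota_rcons perm_sym perm_rcons perm_cons perm_sym.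
  by case/(IHm _ pt): at_ => b bm ->; exists (false :: b); rewrite /= ?bm ?xm.
Qed.

Definition minmax_words m (Q : pred (seq bool)) : seq (seq nat) :=
  [seq minmax_word b | b <- bits m & Q b].

(** Here [r'] is the pattern forbidden besides 213 and 231, and [Q] is its effect on bit
    sequences. *)
Lemma avoiders_minmax m (Q : pred (seq bool)) (r r' : nat -> nat -> nat -> bool) :
    (forall x y z, uniq [:: x; y; z] -> r x y z = middle_first x y z || r' x y z) ->
    (forall b, avoidw r' (minmax_word b) = Q b) ->
  forall w, (w \in minmax_words m Q) = perm_eq w (iota 1 m.+1) && avoidw r w.
Proof.
move=> rE QE w; apply/mapP/andP => [[b] | [pw]].
  rewrite mem_filter mem_bits => /andP[Qb /eqP <-] ->; split; first exact: perm_minmax.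
  by rewrite (eq_avoidw (uniq_minmax b) rE) avoidwU avoid_middle_first_minmax QE.
have Uw : uniq w by rewrite (perm_uniq pw) iota_uniq.
rewrite (eq_avoidw Uw rE) avoidwU => /andP[/(avoid_middle_first pw)[b bm ->]].
by rewrite QE => Qb; exists b; rewrite // mem_filter Qb mem_bits bm /=.
Qed.

Lemma uniq_minmax_words m Q : uniq (minmax_words m Q).
Proof. by rewrite map_inj_uniq ?filter_uniq ?uniq_bits //; apply: minmax_inj. Qed.

(** * Third patterns read on bit sequences *)

Lemma decreasing_minmax b :
  pairwise (fun y z => ~~ (y < z)) (minmax_word b) = (count id b == 0).
Proof.
elim: b => [|[] b IHb] //=.
  apply/andP=> -[/allP/(_ (size b).+2) + _].
  by rewrite mem_map ?mem_minmax; last exact: succn_inj; rewrite leqnn => /(_ isT).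
rewrite IHb andb_idl // => _; apply/allP=> y; rewrite mem_minmax; lia.
Qed.

Lemma increasing_minmax b :
  pairwise (fun y z => ~~ (z < y)) (minmax_word b) = (count negb b == 0).
Proof.
elim: b => [|[] b IHb] //=.
  by rewrite pairwise_map IHb andb_idl // => _; apply/allP=> _ /mapP[y _ ->].
apply/andP=> -[/allP/(_ 1) + _].
by rewrite mem_minmax => /(_ isT).
Qed.

(** A leading least letter forces the rest to decrease, while a leading greatest letter starts no
    123. *)
Lemma avoid123_minmax b :
  avoidw (fun x y z => x < y < z) (minmax_word b) = (count id b <= 1).
Proof.
elim: b => [|[] b IHb] //=.
  rewrite avoidw_map_succ IHb ltnS leqn0 -decreasing_minmax pairwise_map.
  (* All shifted letters exceed the leading 1, so only the comparison of [y] and [z] remains. *)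
  have -> : pairwise (relpre succn (fun y z => ~~ (1 < y < z))) (minmax_word b) =
            pairwise (fun y z => ~~ (y < z)) (minmax_word b).
    apply: (@eq_in_pairwise _ (mem (minmax_word b))); last exact/allP.
    by move=> y z; rewrite !mem_minmax /=; lia.
  by rewrite andb_idr // decreasing_minmax => /eqP->.
rewrite add0n IHb andb_idl // => _; apply/pairwise_subseqP=> y z /mem_subseq/(_ y).
rewrite mem_head mem_minmax => /(_ isT); lia.
Qed.

Lemma avoid321_minmax b :
  avoidw (fun x y z => z < y < x) (minmax_word b) = (count negb b <= 1).
Proof.
elim: b => [|[] b IHb] //=.
  rewrite avoidw_map_succ add0n IHb andb_idl // => _.
  apply/pairwise_subseqP=> y z /mem_subseq/(_ y).
  by rewrite mem_head => /(_ isT)/mapP[y' _ ->]; lia.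
rewrite IHb ltnS leqn0 -increasing_minmax.
have -> : pairwise (fun y z => ~~ (z < y < (size b).+2)) (minmax_word b) =
          pairwise (fun y z => ~~ (z < y)) (minmax_word b).
  apply: (@eq_in_pairwise _ (mem (minmax_word b))); last exact/allP.
  by move=> y z; rewrite !mem_minmax /=; lia.
by rewrite andb_idr // increasing_minmax => /eqP->.
Qed.

(** A leading greatest letter forces the rest to decrease, so no [true] may follow a [false]. *)
Lemma avoid312_minmax b :
  avoidw (fun x y z => y < z < x) (minmax_word b) = pairwise (fun u v => u || ~~ v) b.
Proof.
elim: b => [|[] b IHb] //=.
  rewrite avoidw_map_succ IHb all_predT andb_idl // => _.
  apply/pairwise_subseqP=> y z /mem_subseq/(_ z); rewrite !inE eqxx orbT => /(_ isT).
  by case/mapP=> z' _ ->; lia.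
rewrite IHb.
have -> : pairwise (fun y z => ~~ (y < z < (size b).+2)) (minmax_word b) =
          pairwise (fun y z => ~~ (y < z)) (minmax_word b).
  apply: (@eq_in_pairwise _ (mem (minmax_word b))); last exact/allP.
  by move=> y z; rewrite !mem_minmax /=; lia.
by rewrite decreasing_minmax eqn0Ngt -has_count -all_predC.
Qed.

(** * Fix and pix on bit sequences *)

Lemma count_shiftedSS k l w : count_shifted k.+1 l.+1 w = count_shifted k l w.
Proof. by elim: w k => //= x w IHw k; rewrite IHw addnS eqSS. Qed.

Lemma count_shifted_map_succ k l w :
  count_shifted k l (map succn w) = count_shifted k l.+1 w.
Proof. by elim: w k => //= x w IHw k; rewrite IHw addSnnS. Qed.

Lemma count_shifted_rcons k l w x :
  count_shifted k l (rcons w x) = count_shifted k l w + (x + l == (size w + k).+1).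
Proof.
elim: w k => [|y w IHw] k /=; first by rewrite addn0.
by rewrite IHw addnA addnS addSn.
Qed.

(* For k > 0, at most one i has w_i = i + k in w = minmax_word b. *)
Fixpoint has_shifted (k : nat) (b : seq bool) : bool :=
  if b is u :: b' then
    if u then has_shifted k b' else (k == (size b').+1) || has_shifted k.+1 b'
  else false.

(** A leading least letter is fixed and moves letters and positions alike. A leading greatest letter
    is not fixed and moves positions only, so fixed points then come from letters with w_i = i + 1
    in the rest. *)
Fixpoint fix_bits (b : seq bool) : nat :=
  if b is u :: b' then if u then (fix_bits b').+1 else has_shifted 1 b' else 1.

Lemma has_shifted_large k b : size b < k -> has_shifted k b = false.
Proof. by elim: b k => //= u b IHb k lt_k; rewrite !IHb; case: u; lia. Qed.

Lemma count_shifted_minmax k b :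
  0 < k -> count_shifted k 0 (minmax_word b) = has_shifted k b.
Proof.
elim: b k => [|u b IHb] k k_gt0; first by case: k k_gt0.
case: u => /=.
  rewrite count_shifted_map_succ count_shiftedSS IHb //.
  by case: k k_gt0.
rewrite IHb // addn0 eqSS [_ == k]eq_sym.
(* If the leading greatest letter already has shift [k], the rest is too short to contain one of
   shift [k.+1]. *)
by case: eqP => // ->; rewrite has_shifted_large.
Qed.

Lemma fix_seq_minmax b : fix_seq (minmax_word b) = fix_bits b.
Proof.
elim: b => [|[] b IHb] //; rewrite /fix_seq /=.
  by rewrite count_shifted_map_succ count_shiftedSS -/(fix_seq _) IHb.
by rewrite count_shifted_minmax.
Qed.

Lemma pix_seq_minmax b : pix_seq (minmax_word b) = pix_bits b.
Proof.
rewrite pix_seq_ascents ?uniq_minmax ?ascents_minmax //.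
by rewrite -size_eq0 size_minmax.
Qed.

(** Negating the bits complements the word. Reverse and complement of w have equally many fixed
    points: both count the positions p with w_p + p = n + 1, where n is the length. *)
Lemma fix_seq_rev_minmax b : fix_seq (rev (minmax_word b)) = fix_bits (map negb b).
Proof.
(* The generalized number is a letter offset for the reversed word and a position offset for the
   complement: a letter put in front of the latter goes to the end of the former. *)
rewrite -fix_seq_minmax /fix_seq; elim: b {2 3}0 => [|[] b IHb] k.
- by rewrite /= !addn0 add1n !eqSS eq_sym.
- rewrite /= rev_cons count_shifted_rcons -map_rev count_shifted_map_succ IHb.
  rewrite !size_map size_rev size_minmax !addn0 addnC; congr (nat_of_bool _ + _).
  by rewrite add1n eq_sym.
rewrite /= rev_cons count_shifted_rcons IHb size_rev size_minmax.
rewrite count_shifted_map_succ count_shiftedSS addnC !addn0; congr (nat_of_bool _ + _).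
by lia.
Qed.

Lemma pix_seq_rev_minmax b :
  pix_seq (rev (minmax_word b)) = pix_bits (rev (map negb b)).
Proof.
rewrite pix_seq_ascents ?rev_uniq ?uniq_minmax //.
  by rewrite ascents_rev ?uniq_minmax // ascents_minmax.
by rewrite -size_eq0 size_rev size_minmax.
Qed.

Lemma equidistributed_minmax m (Q : pred (seq bool)) :
    equidistributed_on [seq b <- bits m | Q b] fix_bits pix_bits ->
  equidistributed_on (minmax_words m Q) fix_seq pix_seq.
Proof.
rewrite /equidistributed_on /minmax_words -!map_comp.
by rewrite (eq_map fix_seq_minmax) (eq_map pix_seq_minmax).
Qed.

Lemma perm_filter_bits m (Q Q' : pred (seq bool)) (f : seq bool -> seq bool) :
    injective f -> {mono f : b / size b} -> (forall b, Q b = Q' (f b)) ->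
  (forall b, exists c, f c = b) ->
  perm_eq (map f [seq b <- bits m | Q b]) [seq b <- bits m | Q' b].
Proof.
move=> f_inj szf QQ' f_surj; apply: uniq_perm.
- by rewrite map_inj_uniq ?filter_uniq ?uniq_bits.
- by rewrite filter_uniq ?uniq_bits.
move=> b; have [c <-] := f_surj b.
by rewrite mem_map // !mem_filter !mem_bits szf QQ'.
Qed.

(** With c the negated bits, fix of the reversed word is [fix_bits] of c, but pix is [pix_bits] of c
    reversed. As [Q'] is stable under reversal, this does not change the distribution of pix. *)
Lemma equidistributed_rev_minmax m (Q Q' : pred (seq bool)) :
    (forall b, Q b = Q' (map negb b)) -> (forall b, Q' b = Q' (rev b)) ->
    equidistributed_on [seq b <- bits m | Q' b] fix_bits pix_bits ->
  equidistributed_on (map rev (minmax_words m Q)) fix_seq pix_seq.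
Proof.
move=> QQ' Q'rev; rewrite /equidistributed_on /minmax_words -!map_comp.
rewrite (eq_map fix_seq_rev_minmax) (eq_map pix_seq_rev_minmax).
have pn : perm_eq (map (map negb) [seq b <- bits m | Q b]) [seq b <- bits m | Q' b].
  apply: perm_filter_bits => //; first exact: inj_map negb_inj.
    by move=> b; rewrite size_map.
  by move=> b; exists (map negb b); rewrite mapK //; exact: negbK.
have pr : perm_eq (map rev [seq b <- bits m | Q' b]) [seq b <- bits m | Q' b].
  apply: perm_filter_bits => //; first exact: can_inj (@revK _).
    exact: size_rev.
  by move=> b; exists (rev b); rewrite revK.
move=> eqQ'; set F := filter Q _ in pn *.
rewrite -[X in perm_eq X _]/(map (fix_bits \o map negb) F).
rewrite -[X in perm_eq _ X]/(map (pix_bits \o (rev \o map negb)) F).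
rewrite (map_comp fix_bits) (map_comp pix_bits) (map_comp rev).
rewrite (perm_trans (perm_map _ pn)) // (perm_trans eqQ') // perm_sym perm_map //.
by rewrite (perm_trans (perm_map _ pn)).
Qed.

(** The distribution of a 0/1-valued statistic is determined by how often it is 1. *)
Lemma count_bool_eq (T : Type) (p q : pred T) (s : seq T) j :
  count p s = count q s ->
  count (fun b => p b == j :> nat) s = count (fun b => q b == j :> nat) s.
Proof.
have countE (r : pred T) : count (fun b => r b == j :> nat) s =
    if j is j'.+1 then if j' is 0 then count r s else 0 else size s - count r s.
  case: j => [|[|j]].
  - by rewrite -(count_predC r) addKn; apply: eq_count => b /=; case: (r b).
  - by apply: eq_count => b /=; case: (r b).
  by rewrite -(count_pred0 s); apply: eq_count => b /=; case: (r b).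
by move=> pq; rewrite !countE pq.
Qed.

(** The Jacobsthal numbers 0, 1, 1, 3, 5, 11, ... by the recursion that pix satisfies;
    [jacobsthalSS] is the usual one, which fix needs. *)
Fixpoint jacobsthal (m : nat) : nat := if m is m'.+1 then 2 ^ m' - jacobsthal m' else 0.

Lemma jacobsthal_le m : jacobsthal m <= 2 ^ m.
Proof. case: m => //= m; rewrite expnS; lia. Qed.

Lemma jacobsthalSS m : jacobsthal m.+2 = jacobsthal m.+1 + 2 * jacobsthal m.
Proof. have := jacobsthal_le m; rewrite /= expnS; lia. Qed.

Lemma size_bits m : size (bits m) = 2 ^ m.
Proof. by elim: m => //= m IHm; rewrite size_cat !size_map IHm expnS mul2n addnn. Qed.

(** Splitting on the first bit, a leading [true] keeps the shift and a leading [false] raises it,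
    unless the leading letter itself has the shift. Away from that case the two halves add up by the
    Jacobsthal recursion. *)
Lemma count_has_shifted_bits k m :
  count (has_shifted k.+1) (bits m) = 2 ^ k * jacobsthal (m - k).
Proof.
elim: m k => [|m IHm] k; first by rewrite sub0n muln0.
rewrite [bits _]/= count_cat !count_map IHm.
have [->|km] := eqVneq k m.
  rewrite subnn subSnn muln0 muln1 -size_bits; apply/eqP; rewrite -all_count.
  by apply/allP=> b; rewrite mem_bits => /eqP bm /=; rewrite bm eqxx.
rewrite (@eq_in_count _ _ (has_shifted k.+2)) => [|b]; last first.
  by rewrite mem_bits /= eqSS => /eqP->; rewrite (negPf km).
(* For [m < k] the truncated differences make all the counts 0. *)
rewrite IHm; have [lt_km | lt_mk] : k < m \/ m < k by lia.
  rewrite subSn ?(ltnW lt_km) // -[m - k]prednK ?subn_gt0 // jacobsthalSS -subnS.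
  by rewrite mulnDr expnSr mulnA.
have [-> ->] : m - k = 0 /\ m - k.+1 = 0 by lia.
rewrite (_ : m.+1 - k = 0); last by lia.
by rewrite !muln0.
Qed.

(** A leading [true] never gives pix 0; a leading [false] does exactly when the rest has nonzero
    pix. *)
Lemma count_pix_bits0 m : count (fun b => pix_bits b == 0) (bits m) = jacobsthal m.
Proof.
elim: m => //= m IHm; rewrite count_cat !count_map /=.
rewrite (@eq_count _ _ pred0) // count_pred0 add0n -IHm -size_bits.
rewrite -(count_predC (fun b => pix_bits b == 0)) addKn.
by apply: eq_count => b /=; case: (pix_bits b).
Qed.

Lemma equidistributed_bits m : equidistributed_on (bits m) fix_bits pix_bits.
Proof.
apply/equidistributed_onP; elim: m => // m IHm j.
rewrite /= !count_cat !count_map; congr (_ + _).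
  case: j => [|j]; last exact: IHm.
  by rewrite !(@eq_count _ _ pred0).
apply: count_bool_eq.
by rewrite count_has_shifted_bits count_pix_bits0 mul1n subn0.
Qed.

(** * Bit sequences restricted by a third pattern *)

Fixpoint one_true (m : nat) : seq (seq bool) :=
  if m is m'.+1 then (true :: nseq m' false) :: map (cons false) (one_true m')
  else [:: [::]].

Lemma count_id0 b : (count id b == 0) = (b == nseq (size b) false).
Proof. by elim: b => [|[] b IHb]. Qed.

Lemma mem_one_true m b : (b \in one_true m) = (size b == m) && (count id b <= 1).
Proof.
elim: m b => [|m IHm] [|u b] //=; rewrite inE.
  by apply/mapP=> -[].
rewrite eqSS eqseq_cons; case: u => /=.
  rewrite ltnS leqn0 count_id0 (_ : _ \in _ = false) ?orbF; last first.
    by apply/mapP=> -[].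
  by apply/eqP/andP=> [->|[/eqP<- /eqP]] //; rewrite size_nseq !eqxx.
by rewrite mem_map ?IHm // => c d [].
Qed.

Lemma uniq_one_true m : uniq (one_true m).
Proof.
elim: m => //= m IHm; rewrite map_inj_uniq ?IHm ?andbT => [|c d []] //.
by apply/mapP=> -[].
Qed.

Lemma perm_one_true m : perm_eq [seq b <- bits m | count id b <= 1] (one_true m).
Proof.
apply: uniq_perm; rewrite ?filter_uniq ?uniq_bits ?uniq_one_true // => b.
by rewrite mem_filter mem_bits mem_one_true andbC.
Qed.

Lemma size_one_true m : size (one_true m) = m.+1.
Proof. by elim: m => //= m IHm; rewrite size_map IHm. Qed.

(** The word is [m.+1], ..., 1, so a letter of shift [k] sits at position i with 2i = m + 2 - k. *)
Lemma has_shifted_nseq k m :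
  0 < k -> has_shifted k (nseq m false) = (k <= m) && ~~ odd (m - k).
Proof.
elim: m k => [|m IHm] k k_gt0 /=; first by case: k k_gt0.
rewrite IHm // size_nseq; lia.
Qed.

Lemma pix_bits_nseq m : pix_bits (nseq m false) = ~~ odd m.
Proof. by elim: m => //= m ->; case: odd. Qed.

(** Removing a leading [false] lowers [m] and raises [k], so [m - k] drops by 2. If it is odd, each
    stage contributes the single sequence with a leading [true]; if even, none counts until [k = m],
    where every sequence with a leading [false] does. *)
Lemma count_has_shifted_one_true k m : 0 < k ->
  count (has_shifted k) (one_true m) =
  if k <= m then if odd (m - k) then uphalf (m - k) else m - (m - k)./2 else 0.
Proof.
elim: m k => [|m IHm] k k_gt0; first by case: k k_gt0.
rewrite /= has_shifted_nseq // count_map.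
have [->|km] := eqVneq k m.+1.
  rewrite (@eq_in_count _ _ predT) => [|b]; last first.
    by rewrite mem_one_true => /andP[/eqP bm _] /=; rewrite bm eqxx.
  by rewrite count_predT size_one_true ltnn leqnn subnn subn0.
rewrite (@eq_in_count _ _ (has_shifted k.+1)) => [|b]; last first.
  by rewrite mem_one_true => /andP[/eqP bm _] /=; rewrite bm (negPf km).
rewrite IHm // uphalfE uphalfE; case: (leqP k m) => [le_km | lt_mk].
  rewrite (leqW le_km) subSn //; case: (ltnP k m) => [lt_km | le_mk].
    rewrite -[m - k]prednK ?subn_gt0 // -subnS; move: (m - k.+1) (subnSK lt_km) => d.
    rewrite /= !negbK; case: (odd d) (odd_double_half d); lia.
  have -> : m = k by lia.
  by rewrite subnn /=; lia.
by rewrite !ifF //; lia.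
Qed.

Lemma count_pix_bits0_one_true m :
  count (fun b => pix_bits b == 0) (one_true m) = uphalf m.
Proof.
elim: m => //= m IHm; rewrite count_map add0n.
have := count_predC (fun b => pix_bits b == 0) (one_true m).
rewrite IHm size_one_true (@eq_count _ (predC _) (preim (cons false) (fun b => pix_bits b == 0))).
  by rewrite uphalfE; lia.
by move=> b /=; case: (pix_bits b).
Qed.

Lemma equidistributed_one_true m :
  equidistributed_on [seq b <- bits m | count id b <= 1] fix_bits pix_bits.
Proof.
apply/equidistributed_onP=> j; have /seq.permP := perm_one_true m => -> .
have /seq.permP := perm_one_true m => ->.
case: m => // m; rewrite /= !count_map; congr (_ + _).
  have -> : fix_bits (nseq m false) = pix_bits (nseq m false) => //.
  case: m => // m; rewrite pix_bits_nseq /= has_shifted_nseq // negbK.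
  by case: m => // m; rewrite subn1.
apply: count_bool_eq.
rewrite count_has_shifted_one_true // count_pix_bits0_one_true.
case: m => // m; rewrite subn1 /=; case: (odd m) (odd_double_half m); lia.
Qed.

Lemma equidistributed_on_eq (T : eqType) (L : seq T) (f g : T -> nat) :
  {in L, f =1 g} -> equidistributed_on L f g.
Proof. by move=> /eq_in_map fg; rewrite /equidistributed_on fg. Qed.

(** The statistics agree on each sequence: leading bits [true] add 1 to both, and from the only
    [false] on both are 0. *)
Lemma equidistributed_one_false m :
  equidistributed_on [seq b <- bits m | count negb b <= 1] fix_bits pix_bits.
Proof.
apply: equidistributed_on_eq => b; rewrite mem_filter => /andP[+ _].
elim: b => [|[] b IHb] //=; first by rewrite add0n => /IHb->.
rewrite ltnS leqn0; case: b {IHb} => // -[] b //= b0.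
by rewrite add0n in b0; elim: b b0 => // -[].
Qed.

(** The statistics agree on each sequence: after the leading bits [true] only a decreasing word is
    left, on which both are given by parity. *)
Lemma equidistributed_blocks m :
  equidistributed_on [seq b <- bits m | pairwise (fun u v => u || ~~ v) b] fix_bits pix_bits.
Proof.
apply: equidistributed_on_eq => b; rewrite mem_filter => /andP[+ _].
elim: b => [|[] b IHb] //=; first by move=> /andP[_ /IHb->].
case/andP; rewrite all_predC has_count -eqn0Ngt count_id0 => /eqP-> _.
rewrite has_shifted_nseq // pix_bits_nseq; lia.
Qed.

(** * Classes coded by bit sequences *)

Definition fix_pix_equidistributed (S : seq (seq nat)) : Prop :=
  forall n, exists2 L, lists_avoiders n S L & equidistributed_on L fix_seq pix_seq.

(** Length 0 is separate because [m] bits code a word of [m.+1] letters. *)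
Lemma lists_avoiders0 S : lists_avoiders 0 S [:: [::]].
Proof.
split=> // w; rewrite inE; apply/eqP/andP => [->|[/perm_nilP]] //.
Qed.

Lemma fix_pix_minmax S (Q : pred (seq bool)) (r : nat -> nat -> nat -> bool) :
    (forall x y z, uniq [:: x; y; z] -> has_pattern S x y z = middle_first x y z || r x y z) ->
    (forall b, avoidw r (minmax_word b) = Q b) ->
    (forall m, equidistributed_on [seq b <- bits m | Q b] fix_bits pix_bits) ->
  fix_pix_equidistributed S.
Proof.
move=> SE rE eqQ [|m]; first by exists [:: [::]] => //; apply: lists_avoiders0.
exists (minmax_words m Q); last exact: equidistributed_minmax.
by split; [exact: uniq_minmax_words | exact: (avoiders_minmax _ SE rE)].
Qed.

(** The relation [r] and the predicate [Q] describe the reversed words; [Q'] is [Q] seen on negated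
    bits. *)
Lemma fix_pix_rev_minmax S (Q Q' : pred (seq bool)) (r : nat -> nat -> nat -> bool) :
    (forall x y z, uniq [:: x; y; z] -> has_pattern S z y x = middle_first x y z || r x y z) ->
    (forall b, avoidw r (minmax_word b) = Q b) ->
    (forall b, Q b = Q' (map negb b)) -> (forall b, Q' b = Q' (rev b)) ->
    (forall m, equidistributed_on [seq b <- bits m | Q' b] fix_bits pix_bits) ->
  fix_pix_equidistributed S.
Proof.
move=> SE rE QQ' Q'rev eqQ [|m]; first by exists [:: [::]] => //; apply: lists_avoiders0.
exists (map rev (minmax_words m Q)); last exact: equidistributed_rev_minmax QQ' Q'rev _.
split; first by rewrite map_inj_uniq ?uniq_minmax_words //; apply: can_inj (@revK _).
move=> w; rewrite -{1}[w]revK mem_map; last exact: can_inj (@revK _).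
by rewrite (avoiders_minmax _ SE rE) perm_rev avoidw_rev.
Qed.

(** The three pairwise comparisons of distinct letters determine their standardization, so each of
    the possible orders is checked separately. *)
Ltac order_triples :=
  let x := fresh "x" in let y := fresh "y" in let z := fresh "z" in
  move=> x y z; rewrite /uniq !inE /has_pattern /standardization /middle_first /= !leqnn;
  case: (ltngtP x y) => ? //; case: (ltngtP x z) => ? //; case: (ltngtP y z) => ? //;
  lia.

Lemma avoidw_false w : avoidw (fun _ _ _ => false) w.
Proof. exact/avoidwP. Qed.

Lemma fix_pix_213_231 : fix_pix_equidistributed [:: [:: 2; 1; 3]; [:: 2; 3; 1]].
Proof.
apply: (@fix_pix_minmax _ predT (fun _ _ _ => false)); first by order_triples.
  by move=> b; rewrite avoidw_false.
by move=> m; rewrite filter_predT; apply: equidistributed_bits.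
Qed.

Lemma fix_pix_132_312 : fix_pix_equidistributed [:: [:: 1; 3; 2]; [:: 3; 1; 2]].
Proof.
apply: (@fix_pix_rev_minmax _ predT predT (fun _ _ _ => false)) => //.
- by order_triples.
- by move=> b; rewrite avoidw_false.
by move=> m; rewrite filter_predT; apply: equidistributed_bits.
Qed.

Lemma fix_pix_123_213_231 :
  fix_pix_equidistributed [:: [:: 1; 2; 3]; [:: 2; 1; 3]; [:: 2; 3; 1]].
Proof.
apply: fix_pix_minmax avoid123_minmax equidistributed_one_true.
by order_triples.
Qed.

Lemma fix_pix_213_231_312 :
  fix_pix_equidistributed [:: [:: 2; 1; 3]; [:: 2; 3; 1]; [:: 3; 1; 2]].
Proof.
apply: fix_pix_minmax avoid312_minmax equidistributed_blocks.
by order_triples.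
Qed.

Lemma fix_pix_213_231_321 :
  fix_pix_equidistributed [:: [:: 2; 1; 3]; [:: 2; 3; 1]; [:: 3; 2; 1]].
Proof.
apply: fix_pix_minmax avoid321_minmax equidistributed_one_false.
by order_triples.
Qed.

(** Reversal turns 123 into 321, which allows at most one [false]; negation makes this at most one
    [true]. *)
Lemma fix_pix_123_132_312 :
  fix_pix_equidistributed [:: [:: 1; 2; 3]; [:: 1; 3; 2]; [:: 3; 1; 2]].
Proof.
apply: fix_pix_rev_minmax avoid321_minmax _ _ equidistributed_one_true.
- by order_triples.
- by move=> b; rewrite count_map; congr (_ <= 1); apply: eq_count.
by move=> b; rewrite count_rev.
Qed.

Lemma fix_pix_132_312_321 :
  fix_pix_equidistributed [:: [:: 1; 3; 2]; [:: 3; 1; 2]; [:: 3; 2; 1]].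
Proof.
apply: fix_pix_rev_minmax avoid123_minmax _ _ equidistributed_one_false.
- by order_triples.
- by move=> b; rewrite count_map; congr (_ <= 1); apply: eq_count => -[].
by move=> b; rewrite count_rev.
Qed.

(** * Avoiding 123, 312 and 321 *)

Definition avoiding_words n (S : seq (seq nat)) : seq (seq nat) :=
  [seq w <- permutations (iota 1 n) | avoidw (has_pattern S) w].

Lemma lists_avoiding_words n S : lists_avoiders n S (avoiding_words n S).
Proof.
split; first by rewrite filter_uniq ?permutations_uniq.
by move=> w; rewrite mem_filter mem_permutations andbC.
Qed.

(** The Erdős-Szekeres theorem for monotone triples, obtained by inspecting all ten triples of the
    first five letters. *)
Lemma no_monotone_triple (w : seq nat) : uniq w -> 4 < size w ->
  ~~ avoidw (fun x y z => (x < y < z) || (z < y < x)) w.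
Proof.
case: w => [|a [|b [|c [|d [|e w]]]]] // Uw _; apply/negP=> /avoidwP av.
have s5 (t : seq nat) : subseq t [:: a; b; c; d; e] -> subseq t [:: a, b, c, d, e & w].
  by move=> st; apply: (subseq_trans st); exact: (prefix_subseq [:: a; b; c; d; e] w).
have av5 x y z : subseq [:: x; y; z] [:: a; b; c; d; e] ->
    ~~ (x < y < z) && ~~ (z < y < x).
  by move=> /s5/av; rewrite negb_or.
have ab : a != b by move: Uw; rewrite /= inE; case: eqP.
have sub m : subseq (mask m [:: a; b; c; d; e]) [:: a; b; c; d; e] := mask_subseq m _.
have U5 : uniq [:: a; b; c; d; e].
  by apply: subseq_uniq Uw; apply: s5.
have := av5 _ _ _ (sub [:: true; true; true]).
have := av5 _ _ _ (sub [:: true; true; false; true]).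
have := av5 _ _ _ (sub [:: true; true; false; false; true]).
have := av5 _ _ _ (sub [:: true; false; true; true]).
have := av5 _ _ _ (sub [:: true; false; true; false; true]).
have := av5 _ _ _ (sub [:: true; false; false; true; true]).
have := av5 _ _ _ (sub [:: false; true; true; true]).
have := av5 _ _ _ (sub [:: false; true; true; false; true]).
have := av5 _ _ _ (sub [:: false; true; false; true; true]).
have := av5 _ _ _ (sub [:: false; false; true; true; true]).
move: U5; rewrite /= !inE; move: {av5 sub s5 av Uw} ab.
case: (ltngtP a b) => //=; case: (ltngtP b c) => //=; case: (ltngtP c d) => //=;
 case: (ltngtP a c) => //=; case: (ltngtP b d) => //=;
 case: (ltngtP d e) => //=; lia.
Qed.

Lemma fix_pix_123_312_321 :
  fix_pix_equidistributed [:: [:: 1; 2; 3]; [:: 3; 1; 2]; [:: 3; 2; 1]].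
Proof.
move=> n; exists (avoiding_words n [:: [:: 1; 2; 3]; [:: 3; 1; 2]; [:: 3; 2; 1]]).
  exact: lists_avoiding_words.
case: n => [|[|[|[|[|n]]]]]; try by vm_compute.
set S := [:: _; _; _]; suff: avoiding_words n.+4.+1 S == [::] by move/eqP->.
rewrite -[_ == _]negbK -has_filter -all_predC; apply/allP=> w.
rewrite mem_permutations => pw; have Uw : uniq w by rewrite (perm_uniq pw) iota_uniq.
apply: contra (no_monotone_triple Uw _); last by rewrite (perm_size pw) size_iota.
have SE x y z : uniq [:: x; y; z] ->
    has_pattern S x y z = ((x < y < z) || (z < y < x)) || (y < z < x).
  by move: x y z; rewrite /S; order_triples.
by rewrite (eq_avoidw Uw SE) (avoidwU (fun x y z => (x < y < z) || (z < y < x))) => /andP[].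
Qed.

(** * Avoiding 132 and 321 *)

Definition block_swap n k : seq nat := iota k.+1 (n - k) ++ iota 1 k.

Fixpoint padded_swaps n : seq (seq nat) :=
  if n is n'.+1 then
    map (rcons^~ n) (padded_swaps n') ++ [seq block_swap n k | k <- iota 1 n']
  else [::].

Lemma mem_block_swap n k x : k <= n -> (x \in block_swap n k) = (0 < x <= n).
Proof. by move=> le_kn; rewrite mem_cat !mem_iota; lia. Qed.

Lemma uniq_block_swap n k : uniq (block_swap n k).
Proof.
rewrite cat_uniq !iota_uniq andbT; apply/hasPn=> x.
by rewrite !mem_iota; lia.
Qed.

Lemma perm_block_swap n k : k <= n -> perm_eq (block_swap n k) (iota 1 n).
Proof.
move=> le_kn; apply: uniq_perm; rewrite ?iota_uniq ?uniq_block_swap // => x.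
by rewrite mem_block_swap // mem_iota add1n ltnS.
Qed.

Lemma ascents_iota_cat a c w :
  ascents (iota a c.+1 ++ w) = nseq c true ++ pairmap ltn (a + c) w.
Proof.
elim: c a => [|c IHc] a; first by rewrite addn0.
by have := IHc a.+1; rewrite /= ltnSn addSnnS => ->.
Qed.

Lemma ascents_iota n : ascents (iota 1 n.+1) = nseq n true.
Proof. by have := ascents_iota_cat 1 n [::]; rewrite !cats0. Qed.

Lemma ascents_block_swap n k : 0 < k <= n ->
  ascents (block_swap n.+1 k) = nseq (n - k) true ++ false :: nseq k.-1 true.
Proof.
case: k => // k lt_kn; rewrite /block_swap subSn // ascents_iota_cat /=.
by have := ascents_iota k; rewrite /= => ->; rewrite ltnS leqNgt.
Qed.

Lemma pix_bits_true_cat c b : pix_bits (nseq c true ++ b) = c + pix_bits b.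
Proof. by elim: c => //= c ->. Qed.

Lemma pix_bits_nseq_true c : pix_bits (nseq c true) = c.+1.
Proof. by elim: c => //= c ->. Qed.

(** The last letter of the first block followed by the second block has its first non-descent at 2,
    hence is a desarrangement; the [n - k] letters before it increase. *)
Lemma pix_block_swap n k : 0 < k <= n -> pix_seq (block_swap n.+1 k) = n - k.
Proof.
move=> k_bnd; rewrite pix_seq_ascents ?uniq_block_swap //.
  by rewrite ascents_block_swap // pix_bits_true_cat /= pix_bits_nseq_true addn0.
by rewrite -size_eq0 size_cat !size_iota; lia.
Qed.

Lemma count_shifted_cat k l w1 w2 :
  count_shifted k l (w1 ++ w2) = count_shifted k l w1 + count_shifted (size w1 + k) l w2.
Proof. by elim: w1 k => //= x w IHw k; rewrite IHw addnA addnS. Qed.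

Lemma count_shifted_iota k a n : count_shifted k 0 (iota a n) = (a == k.+1) * n.
Proof.
elim: n k a => [|n IHn] k a; first by rewrite muln0.
by rewrite /= IHn addn0 eqSS mulnS.
Qed.

Lemma fix_block_swap n k : 0 < k <= n -> fix_seq (block_swap n.+1 k) = 0.
Proof.
move=> k_bnd; rewrite /fix_seq count_shifted_cat !count_shifted_iota size_iota.
by rewrite !eqSS; case: eqP => [|_]; [lia|case: eqP => [|_]; lia].
Qed.

(** Behind a descent only the vanishing of pix matters, and a tail consisting of ascents has
    positive pix already, so a further ascent changes nothing there. *)
Lemma pix_bits_rcons_true b : pix_bits (rcons b true) = pix_bits b + all id b.
Proof.
elim: b => [|[] b IHb] //=; rewrite IHb ?addSn // addn0.
by case: b {IHb} => [|[] b] //=; rewrite ?addn0.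
Qed.

Lemma padded_swaps_perm n w :
  w \in padded_swaps n -> perm_eq w (iota 1 n) && ~~ all id (ascents w).
Proof.
elim: n w => // n IHn w /=; rewrite mem_cat => /orP[/mapP[v /IHn] | /mapP[k]].
  case/andP=> pv /allPn asc_v ->; rewrite -/(iota 1 n.+1) iota_rcons perm_rcons.
  rewrite perm_sym perm_rcons perm_cons perm_sym pv /=.
  case: (lastP v) asc_v => [[]//|v' x] [u uv nu].
  by rewrite ascents_rcons2 all_rcons negb_and; apply/orP; right; apply/allPn; exists u.
rewrite mem_iota => k_bnd ->; rewrite perm_block_swap; last by lia.
by rewrite ascents_block_swap ?all_cat /= ?andbF //; lia.
Qed.

Lemma ascents_rcons_max n w :
  perm_eq w (iota 1 n) -> w != [::] -> ascents (rcons w n.+1) = rcons (ascents w) true.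
Proof.
case: (lastP w) => // v x pw _; rewrite ascents_rcons2.
have := perm_mem pw x; rewrite mem_iota mem_rcons mem_head => /esym x_bnd.
by congr rcons; lia.
Qed.

Lemma fix_rcons_max n w :
  perm_eq w (iota 1 n) -> fix_seq (rcons w n.+1) = (fix_seq w).+1.
Proof.
move=> /perm_size; rewrite size_iota /fix_seq count_shifted_rcons => ->.
by rewrite !addn0 eqxx addn1.
Qed.

Lemma uniq_perm_iota n w : perm_eq w (iota 1 n) -> uniq w.
Proof. by move=> /perm_uniq->; apply: iota_uniq. Qed.

Lemma pix_rcons_max n w :
  w \in padded_swaps n -> pix_seq (rcons w n.+1) = pix_seq w.
Proof.
move=> /padded_swaps_perm/andP[pw asc_w].
have w0 : w != [::] by case: w asc_w {pw}.
have Uw := uniq_perm_iota pw; rewrite pix_seq_ascents; first last.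
- by rewrite -size_eq0 size_rcons.
- by rewrite rcons_uniq Uw andbT (perm_mem pw) mem_iota add1n ltnn andbF.
by rewrite (ascents_rcons_max pw) // pix_bits_rcons_true (negPf asc_w) addn0 pix_seq_ascents.
Qed.

(** Appending the greatest letter adds a fixed point, and the new exchanges of blocks have none. *)
Lemma count_padded_swaps_fix n j :
  count (fun w => fix_seq w == j) (padded_swaps n) = n.-1 - j.
Proof.
elim: n j => // n IHn j; rewrite /= count_cat !count_map.
rewrite (@eq_in_count _ _ (fun w => (fix_seq w).+1 == j)); last first.
  by move=> w /padded_swaps_perm/andP[pw _] /=; rewrite fix_rcons_max.
rewrite [X in _ + X](@eq_in_count _ _ (fun=> j == 0)); last first.
  by move=> k; rewrite mem_iota => k_bnd /=; rewrite fix_block_swap 1?eq_sym //; lia.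
case: j => [|j] /=.
  by rewrite (eq_count (a2 := pred0)) // count_pred0 count_predT size_iota; lia.
by rewrite (eq_count (a2 := fun w => fix_seq w == j)) // IHn count_pred0; lia.
Qed.

(** Appending the greatest letter keeps pix, and the new exchanges of blocks take each value from 0
    on exactly once. The counts thus agree with those of fix although the two recursions differ. *)
Lemma count_padded_swaps_pix n j :
  count (fun w => pix_seq w == j) (padded_swaps n) = n.-1 - j.
Proof.
elim: n j => // n IHn j; rewrite /= count_cat !count_map.
rewrite (@eq_in_count _ _ (fun w => pix_seq w == j)); last first.
  by move=> w w_in /=; rewrite pix_rcons_max.
rewrite IHn [X in _ + X](@eq_in_count _ _ (pred1 (n - j))); last first.
  by move=> k; rewrite mem_iota => k_bnd /=; rewrite pix_block_swap; lia.
by rewrite count_uniq_mem ?iota_uniq // mem_iota; lia.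
Qed.

Lemma fix_seq_iota n : fix_seq (iota 1 n) = n.
Proof. by rewrite /fix_seq count_shifted_iota mul1n. Qed.

Lemma pix_seq_iota n : pix_seq (iota 1 n) = n.
Proof.
case: n => // n; rewrite pix_seq_ascents ?iota_uniq //.
by rewrite ascents_iota pix_bits_nseq_true.
Qed.

Lemma equidistributed_padded_swaps n :
  equidistributed_on (iota 1 n :: padded_swaps n) fix_seq pix_seq.
Proof.
apply/equidistributed_onP=> j /=.
by rewrite count_padded_swaps_fix count_padded_swaps_pix fix_seq_iota pix_seq_iota.
Qed.

Lemma last_block_swap n k x : 0 < k -> last x (block_swap n k) = k.
Proof. by case: k => // k _; rewrite /block_swap iota_rcons last_cat last_rcons. Qed.

(** The last letter tells the exchanges of blocks from each other and from the padded words. *)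
Lemma uniq_padded_swaps n : uniq (iota 1 n :: padded_swaps n).
Proof.
rewrite /=; apply/andP; split.
  apply/negP=> /padded_swaps_perm/andP[_]; case: n => // n.
  by rewrite ascents_iota all_nseq orbT.
elim: n => //= n IHn; rewrite cat_uniq; apply/and3P; split.
- by rewrite map_inj_uniq // => ? ?; apply: rcons_injl.
- apply/hasPn=> w0 /mapP[k]; rewrite mem_iota => k_bnd ->.
  apply/negP=> /mapP[w _] /(congr1 (last 0)).
  by rewrite last_rcons last_block_swap; lia.
rewrite map_inj_in_uniq ?iota_uniq // => k1 k2; rewrite !mem_iota => k1_bnd k2_bnd.
by move/(congr1 (last 0)); rewrite !last_block_swap; lia.
Qed.

Lemma avoidw_rcons r w x :
  avoidw r (rcons w x) = avoidw r w && pairwise (fun y z => ~~ r y z x) w.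
Proof.
elim: w => //= y w ->; rewrite pairwise_rcons.
by rewrite -!andbA; do !bool_congr.
Qed.

(** The order in which the letters of [block_swap n k] occur: those above [k] first, each block
    increasing. *)
Definition swap_order (k x y : nat) : bool :=
  if (k < x) == (k < y) then x < y else k < x.

Lemma swap_order_trans k : transitive (swap_order k).
Proof.
move=> y x z; rewrite /swap_order.
by case: (ltnP k x); case: (ltnP k y); case: (ltnP k z) => /=; lia.
Qed.

Lemma swap_order_irr k : irreflexive (swap_order k).
Proof. by move=> x; rewrite /swap_order eqxx ltnn. Qed.

Lemma sorted_block_swap n k : sorted (swap_order k) (block_swap n k).
Proof.
rewrite sorted_pairwise; last exact: swap_order_trans.
have sorted_iota a c : pairwise ltn (iota a c).
  by rewrite -sorted_pairwise ?iota_ltn_sorted //; apply: ltn_trans.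
rewrite pairwise_cat; apply/and3P; split.
- apply/allrelP=> x y; rewrite !mem_iota /swap_order.
  by case: (ltnP k x); case: (ltnP k y) => /=; lia.
- apply: (@sub_in_pairwise _ (mem (iota k.+1 (n - k))) ltn) (sorted_iota _ _); last exact/allP.
  by move=> x y; rewrite !mem_iota /swap_order; case: (ltnP k x); case: (ltnP k y) => /=; lia.
apply: (@sub_in_pairwise _ (mem (iota 1 k)) ltn) (sorted_iota _ _); last exact/allP.
by move=> x y; rewrite !mem_iota /swap_order; case: (ltnP k x); case: (ltnP k y) => /=; lia.
Qed.

Lemma subseq_triple (T : eqType) (a b c : T) s : uniq s ->
  subseq [:: a; b] s -> subseq [:: b; c] s -> subseq [:: a; b; c] s.
Proof.
elim: s => // d s IHs /= /andP[ds Us].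
have [_|_] := eqVneq a d; last first.
  have [-> /mem_subseq/(_ d)|_] := eqVneq b d; last exact: IHs.
  by rewrite !inE eqxx orbT (negPf ds) => /(_ isT).
have [->|_ _] := eqVneq b d; last by [].
by rewrite sub1seq (negPf ds).
Qed.

Definition bad_132_321 (x y z : nat) : bool := (x < z < y) || (z < y < x).

(** Three letters listed in such an order form 123, 231 or 312, the rotations of an increasing
    triple. *)
Lemma avoid_sorted_swap k w : sorted (swap_order k) w -> avoidw bad_132_321 w.
Proof.
rewrite sorted_pairwise; last exact: swap_order_trans.
move=> sw; apply/avoidwP=> x y z /subseq_pairwise/(_ sw) /=.
rewrite /swap_order /bad_132_321.
by case: (ltnP k x); case: (ltnP k y); case: (ltnP k z) => /=; lia.
Qed.

Lemma avoid_sorted_iota n : avoidw bad_132_321 (iota 1 n).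
Proof.
apply: (@avoid_sorted_swap 0).
apply: (@sub_in_sorted _ (mem (iota 1 n)) ltn) (iota_ltn_sorted 1 n); last exact/allP.
by move=> x y; rewrite !mem_iota /swap_order => /andP[-> _] /andP[-> _].
Qed.

(** For the harder inclusion, a last letter [n.+1] is removed by induction. Any other last letter
    [k] forces the word to be sorted for [swap_order k]. *)
Lemma mem_padded_swaps n w :
  (w \in iota 1 n :: padded_swaps n) = perm_eq w (iota 1 n) && avoidw bad_132_321 w.
Proof.
apply/idP/idP.
  rewrite inE => /predU1P[->|].
    by rewrite perm_refl avoid_sorted_iota.
  move=> w_in; have /andP[-> _] /= := padded_swaps_perm w_in.
  elim: n w w_in => // n IHn w; rewrite /= mem_cat => /orP[] /mapP[]; last first.
    by move=> k _ ->; apply: avoid_sorted_swap (sorted_block_swap _ _).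
  move=> v v_in ->; rewrite avoidw_rcons IHn //=.
  have /andP[/perm_mem pv _] := padded_swaps_perm v_in.
  apply/pairwise_subseqP=> y z /mem_subseq yz.
  move: (yz y) (yz z); rewrite !inE !eqxx orbT !pv !mem_iota /bad_132_321.
  by move=> /(_ isT) ? /(_ isT) ?; lia.
elim: n w => [|n IHn] w; first by case/andP=> /perm_nilP->.
case: (lastP w) => [/andP[/perm_size]//|t k] /andP[pw].
have memw x : (x \in rcons t k) = (0 < x <= n.+1).
  by rewrite (perm_mem pw) mem_iota add1n ltnS.
have [Ut kt] : uniq t /\ k \notin t.
  by have := uniq_perm_iota pw; rewrite rcons_uniq => /andP[].
rewrite avoidw_rcons => /andP[avt /pairwise_subseqP avk].
have [kn|kn] := eqVneq k n.+1.
  have pt : perm_eq t (iota 1 n).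
    by move: pw; rewrite kn iota_rcons perm_rcons perm_sym perm_rcons perm_cons perm_sym.
  have := IHn t; rewrite pt avt kn inE => /(_ isT) /predU1P[->|t_in].
    by rewrite -iota_rcons mem_head.
  rewrite inE /= mem_cat (mem_map (f := rcons^~ n.+1)) ?t_in ?orbT // => ? ?.
  exact: rcons_injl.
have k_bnd : 0 < k <= n.+1 by rewrite -memw mem_rcons mem_head.
have nt : n.+1 \in t.
  by have := memw n.+1; rewrite mem_rcons inE eq_sym (negPf kn) leqnn.
suff -> : rcons t k = block_swap n.+1 k.
  rewrite inE /= mem_cat [_ \in [seq block_swap _ _ | _ <- _]](_ : _ = true) ?orbT //.
  by apply/mapP; exists k; rewrite // mem_iota; lia.
(* Two words with the same letters, both sorted for one strict order, are equal. *)
apply: (irr_sorted_eq (@swap_order_trans k) (@swap_order_irr k)).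
- rewrite sorted_pairwise; last exact: swap_order_trans.
  rewrite pairwise_rcons; apply/andP; split.
    apply/allP=> y yt; have yk : y != k by apply: contraNneq kt => <-.
    by rewrite /swap_order ltnn; case: (ltnP k y) => /=; lia.
  apply/pairwise_subseqP=> y z yz.
  have [yt zt] : y \in t /\ z \in t.
    by split; apply: (mem_subseq yz); rewrite !inE eqxx ?orbT.
  have yk : y != k by apply: contraNneq kt => <-.
  have zk : z != k by apply: contraNneq kt => <-.
  have yNz : y != z by have := subseq_uniq yz Ut; rewrite /= inE andbT.
  have y_bnd : 0 < y <= n.+1 by rewrite -memw mem_rcons inE yt orbT.
  have := avk _ _ yz; rewrite /swap_order /bad_132_321.
  (* Avoidance with [k] as last letter settles all pairs except a descent below [k]. There the
     letter [n.+1] gives 132 with [y] and [k] if it comes after [y], and 321 with [y] and [z] if it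
     comes before. *)
  have [lt_kmax | ] := boolP ((y < k) && (z < y)); last first.
    by case: (ltnP k y); case: (ltnP k z) => /=; lia.
  have yn : y != n.+1 by lia.
  case/orP: (subseq_pair yt nt yn) => [/avk|ny]; first by rewrite /bad_132_321; lia.
  by have /avoidwP/(_ _ _ _ (subseq_triple Ut ny yz)) := avt; rewrite /bad_132_321; lia.
- exact: sorted_block_swap.
by move=> x; rewrite memw mem_block_swap //; case/andP: k_bnd.
Qed.

Lemma fix_pix_132_321 : fix_pix_equidistributed [:: [:: 1; 3; 2]; [:: 3; 2; 1]].
Proof.
move=> n; exists (iota 1 n :: padded_swaps n); last exact: equidistributed_padded_swaps.
split; first exact: uniq_padded_swaps.
move=> w; rewrite mem_padded_swaps; case pw: perm_eq => //=.
apply: eq_avoidw; first exact: uniq_perm_iota pw.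
by rewrite /bad_132_321; order_triples.
Qed.

(** * The classification *)

(** Each set lists its patterns in the order of [words3], so that a mask of [words3] can be looked
    up here directly. *)
Definition equidistributed_patterns : seq (seq (seq nat)) :=
  [:: [:: [:: 1; 3; 2]; [:: 3; 1; 2]];
      [:: [:: 1; 3; 2]; [:: 3; 2; 1]];
      [:: [:: 2; 1; 3]; [:: 2; 3; 1]];
      [:: [:: 1; 2; 3]; [:: 1; 3; 2]; [:: 3; 1; 2]];
      [:: [:: 1; 2; 3]; [:: 2; 1; 3]; [:: 2; 3; 1]];
      [:: [:: 1; 2; 3]; [:: 3; 1; 2]; [:: 3; 2; 1]];
      [:: [:: 1; 3; 2]; [:: 3; 1; 2]; [:: 3; 2; 1]];
      [:: [:: 2; 1; 3]; [:: 2; 3; 1]; [:: 3; 1; 2]];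
      [:: [:: 2; 1; 3]; [:: 2; 3; 1]; [:: 3; 2; 1]]].

Lemma fix_pix_equidistributed_patterns :
  forall S, S \in equidistributed_patterns -> fix_pix_equidistributed S.
Proof.
move=> S; rewrite !inE.
do 8?[case/predU1P => [->|]]; last move/eqP->.
- exact: fix_pix_132_312.
- exact: fix_pix_132_321.
- exact: fix_pix_213_231.
- exact: fix_pix_123_132_312.
- exact: fix_pix_123_213_231.
- exact: fix_pix_123_312_321.
- exact: fix_pix_132_312_321.
- exact: fix_pix_213_231_312.
- exact: fix_pix_213_231_321.
Qed.

Lemma mem_pattern_words k (ws : seq (seq nat)) :
    all (perm_eq^~ (iota 1 k)) ws -> pattern_words (patterns k ws) =i ws.
Proof.
move=> /allP wsk w; apply/imageP/idP => [[s + ->] | w_ws]; first by rewrite inE.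
by have [s sw] := word_surj (wsk _ w_ws); exists s; rewrite // inE sw.
Qed.

Lemma pattern_words_perm (P : {set 'S_3}) (s : 'S_3) :
  (word s \in pattern_words P) = (s \in P).
Proof. exact/mem_image/word_inj. Qed.

Lemma eq_lists_avoiders n S S' L : S =i S' -> lists_avoiders n S L -> lists_avoiders n S' L.
Proof.
move=> SS' [UL memL]; split=> // w; rewrite memL; case pw: perm_eq => //=.
by apply: eq_avoidw => [|x y z _]; [exact: uniq_perm_iota pw | rewrite /has_pattern SS'].
Qed.

Definition words3 : seq (seq nat) :=
  [:: [:: 1; 2; 3]; [:: 1; 3; 2]; [:: 2; 1; 3]; [:: 2; 3; 1]; [:: 3; 1; 2]; [:: 3; 2; 1]].

Lemma mem_words3 w : (w \in words3) = perm_eq w (iota 1 3).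
Proof.
rewrite -mem_permutations; apply: perm_mem.
by vm_compute.
Qed.

(** The masks run through all sets of one to three patterns, and the lengths 0 to 5 suffice to
    exclude every set off the list. *)
Lemma small_equidistributed :
  all (fun m => (0 < count id m <= 3) ==>
        all (fun n => equidistributed_on (avoiding_words n (mask m words3)) fix_seq pix_seq)
            (iota 0 6) ==>
        (mask m words3 \in equidistributed_patterns)) (bits 6).
Proof. by vm_compute. Qed.

Theorem mainTheorem2 (P : {set 'S_3}) (hP : 1 <= #|P| <= 3) :
  (forall n : nat,
     equidistributed (avoiders n P) (@fix_stat n) (@pix_stat n)) <->
  P \in [:: patterns 3 [:: [:: 1; 3; 2]; [:: 3; 1; 2]];
            patterns 3 [:: [:: 1; 3; 2]; [:: 3; 2; 1]];
            patterns 3 [:: [:: 2; 1; 3]; [:: 2; 3; 1]];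
            patterns 3 [:: [:: 1; 2; 3]; [:: 1; 3; 2]; [:: 3; 1; 2]];
            patterns 3 [:: [:: 1; 2; 3]; [:: 2; 1; 3]; [:: 2; 3; 1]];
            patterns 3 [:: [:: 1; 2; 3]; [:: 3; 1; 2]; [:: 3; 2; 1]];
            patterns 3 [:: [:: 1; 3; 2]; [:: 3; 1; 2]; [:: 3; 2; 1]];
            patterns 3 [:: [:: 2; 1; 3]; [:: 2; 3; 1]; [:: 3; 1; 2]];
            patterns 3 [:: [:: 2; 1; 3]; [:: 2; 3; 1]; [:: 3; 2; 1]]].
Proof.
rewrite -[X in P \in X]/(map (patterns 3) equidistributed_patterns).
split=> [eqP | /mapP[S S_in ->] n]; last first.
  have [L LS eqL] := fix_pix_equidistributed_patterns S_in n.
  apply/(equidistributed_avoiders (L := L)) => //.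
  apply: eq_lists_avoiders LS => w; rewrite mem_pattern_words //.
  by apply: (allP (_ : all (all (perm_eq^~ (iota 1 3))) equidistributed_patterns)).
(* The characteristic sequence of [P] along the six permutations links [P] to the finite check. *)
pose m := [seq w \in pattern_words P | w <- words3].
have mE : mask m words3 =i pattern_words P.
  move=> w; rewrite -filter_mask mem_filter mem_words3; apply: andb_idr.
  by case/imageP=> s _ ->; apply: perm_word.
have count_m : count id m = #|P|.
  rewrite /m count_map -size_filter cardE -(size_map (@word 3)); apply/perm_size/uniq_perm.
  - exact: filter_uniq.
  - by rewrite map_inj_uniq ?enum_uniq //; apply: word_inj.
  by move=> w; rewrite filter_mask mE.
have := allP small_equidistributed m; rewrite mem_bits size_map => /(_ isT).
rewrite count_m hP implyTb => /implyP m_in; apply/mapP; exists (mask m words3).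
  apply: m_in; apply/allP=> n _.
  rewrite -(equidistributed_avoiders (P := P)); first exact: eqP.
  exact: eq_lists_avoiders (lists_avoiding_words _ _).
by apply/setP=> s; rewrite inE mE pattern_words_perm.
Qed.
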